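(* Let $k$ be a field and $A=k[x_1,\ldots,x_d]$ the polynomial Hopf algebra. There is a one-to-one correspondence between Poisson Hopf structures on $A$ and co-Poisson Hopf structures on $A$. More precisely, assume $$\{x_i,x_j\}=\lambda_1^{ij}x_1+\cdots+\lambda_d^{ij}x_d\qquad(1\le i,j\le d,\ \lambda^{ij}_s\in k)$$ is a Poisson Hopf structure on $A$. Let $I:A\to A\otimes A$ be the linear map with $$I(x_s)=\sum_{1\le i,j\le d}\lambda_s^{ij}\,x_i\otimes x_j\quad\text{for all }1\le s\le d$$ and $I(a)=0$ for all other monic monomials $a$. Then $q(a)=\sum I(a_1)\Delta(a_2)$ defines a co-Poisson Hopf structure on $A$.
   Context: $A=k[x_1,\ldots,x_d]$ is the Hopf algebra (universal enveloping algebra of the $d$-dimensional abelian Lie algebra) whose comultiplication $\Delta$ is the algebra map with $\Delta(x_i)=x_i\otimes1+1\otimes x_i$. Sweedler notation: $\Delta(a)=\sum a_1\otimes a_2$; products $I(a_1)\Delta(a_2)$ are taken in $A\otimes A$. A Poisson Hopf structure on $A$ is a Lie bracket $\{-,-\}$ on $A$ with $\{ab,c\}=a\{b,c\}+\{a,c\}b$ and $\Delta(\{a,b\})=\sum\{a_1,b_1\}\otimes a_2b_2+\sum a_1b_1\otimes\{a_2,b_2\}$ for all $a,b,c\in A$; it is determined by the values $\{x_i,x_j\}$. $t_n:V^{\otimes n}\to V^{\otimes n}$ is $v_1\otimes\cdots\otimes v_n\mapsto v_n\otimes v_1\otimes\cdots\otimes v_{n-1}$. A co-Poisson Hopf structure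 on $A$ is a linear map $q:A\to A\otimes A$ with $(1+t_2)q=0$, $(1+t_3+t_3^2)(q\otimes1)q=0$, $(\Delta\otimes1)q=(1\otimes q)\Delta-t_3^2(q\otimes1)\Delta$, and $q(ab)=q(a)\Delta(b)+\Delta(a)q(b)$ for all $a,b\in A$.
   Formalization: The one-to-one correspondence is stated for k of characteristic 0 only, since it fails in characteristic p (d=1: q(x)=x⊗x^p−x^p⊗x is a nonzero co-Poisson Hopf structure, but the only Poisson one is 0); the explicit construction of q is stated for every field. *)

(* Defs.v *)
From HB Require Import structures.
From mathcomp Require Import all_boot all_order all_algebra.
From mathcomp Require Import mpoly.

Set Implicit Arguments.
Unset Strict Implicit.
Unset Printing Implicit Defensive.

Import GRing.Theory.
Local Open Scope ring_scope.

(* [tpow k d n] is the n-fold tensor power over k of A = k[x_1, ..., x_d],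
   realised as the polynomial ring in the n * d variables
   x_(p,i) = 1 ⊗ ... ⊗ x_i ⊗ ... ⊗ 1, with x_i in position p.  The variable
   x_(p,i) has index [mxvec_index p i]. *)
Notation tpow k d n := {mpoly k[(n * d)%N]}.

Section TensorPowers.
Variables (k : fieldType) (d : nat).
Local Notation A := {mpoly k[d]}.

(* The algebra map a |-> 1 ⊗ ... ⊗ a ⊗ ... ⊗ 1, with a in position p. *)
Definition leg n (p : 'I_n) (a : A) : tpow k d n :=
  a \mPo [tuple 'X_(mxvec_index p i) | i < d].

(* The pure tensor v_1 ⊗ ... ⊗ v_n. *)
Definition tens n (v : n.-tuple A) : tpow k d n :=
  \prod_(p < n) leg p (tnth v p).

Definition mleg n (m : 'X_{1..(n * d)%N}) (p : 'I_n) : 'X_{1..d} :=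
  [multinom m (mxvec_index p i) | i < d].

(* The linear map on the tensor power induced by a multilinear f, that is,
   v_1 ⊗ ... ⊗ v_n |-> f [tuple v_1; ...; v_n]; it is defined by its values on
   the basis of pure tensors of monomials (see [mpolyX_tens], [mleg_bij]). *)
Definition tlift n (W : lmodType k) (f : n.-tuple A -> W) (u : tpow k d n) : W :=
  \sum_(m <- msupp u) u@_m *: f [tuple 'X_[mleg m p] | p < n].

Definition tens2 (a b : A) : tpow k d 2 := tens [tuple a; b].

Definition tlift2 (W : lmodType k) (f : A -> A -> W) : tpow k d 2 -> W :=
  tlift (fun v : 2.-tuple A => f (tnth v ord0) (tnth v ord_max)).

(* The identification of A^{⊗m} ⊗ A^{⊗n} with A^{⊗(m+n)}. *)
Definition tcat m n (u : tpow k d m) (w : tpow k d n) : tpow k d (m + n) :=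
  tlift (fun x : m.-tuple A =>
    tlift (fun y : n.-tuple A => tens [tuple of x ++ y]) w) u.

(* f ⊗ 1 and 1 ⊗ f, for a linear map f : A -> A ⊗ A. *)
Definition tmapl (f : A -> tpow k d 2) : tpow k d 2 -> tpow k d 3 :=
  tlift2 (fun a b => tcat (f a) (tens [tuple b])).

Definition tmapr (f : A -> tpow k d 2) : tpow k d 2 -> tpow k d 3 :=
  tlift2 (fun a b => tcat (tens [tuple a]) (f b)).

(* v_1 ⊗ ... ⊗ v_n |-> v_n ⊗ v_1 ⊗ ... ⊗ v_(n-1). *)
Definition trot n : tpow k d n -> tpow k d n :=
  tlift (fun v : n.-tuple A => tens [tuple of rotr 1 v]).

Definition Delta (a : A) : tpow k d 2 :=
  a \mPo [tuple tens2 'X_i 1 + tens2 1 'X_i | i < d].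

(* The Sweedler sum \sum f(a_1, a_2), for f bilinear. *)
Definition sweedler (W : lmodType k) (f : A -> A -> W) (a : A) : W :=
  tlift2 f (Delta a).

Record poisson_hopf (br : A -> A -> A) : Prop := {
  br_linear_l : forall c, linear (br^~ c);
  br_linear_r : forall c, linear (br c);
  br_alternating : forall a, br a a = 0;
  br_jacobi : forall a b c,
    br a (br b c) + br b (br c a) + br c (br a b) = 0;
  br_leibniz : forall a b c, br (a * b) c = a * br b c + br a c * b;
  br_Delta : forall a b,
    Delta (br a b)
    = sweedler (fun a1 a2 =>
        sweedler (fun b1 b2 => tens2 (br a1 b1) (a2 * b2)) b) a
    + sweedler (fun a1 a2 =>
        sweedler (fun b1 b2 => tens2 (a1 * b1) (br a2 b2)) b) a
}.

Record copoisson_hopf (q : A -> tpow k d 2) : Prop := {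
  q_linear : linear q;
  q_skew : forall a, q a + trot (q a) = 0;
  q_cojacobi : forall a,
    let u := tmapl q (q a) in u + trot u + trot (trot u) = 0;
  q_coleibniz : forall a,
    tmapl Delta (q a)
    = tmapr q (Delta a) - trot (trot (tmapl q (Delta a)));
  q_mul : forall a b, q (a * b) = q a * Delta b + Delta a * q b
}.

(* [lam s i j] is the coefficient written lambda_s^{ij}. *)
Definition linear_bracket (lam : 'I_d -> 'I_d -> 'I_d -> k)
    (br : A -> A -> A) : Prop :=
  forall i j, br 'X_i 'X_j = \sum_(s < d) lam s i j *: 'X_s.

Definition dual_map (lam : 'I_d -> 'I_d -> 'I_d -> k)
    (I : {linear A -> tpow k d 2}) : Prop :=
  (forall s, I 'X_s = \sum_(i < d) \sum_(j < d) lam s i j *: tens2 'X_i 'X_j)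
  /\ (forall m : 'X_{1..d}, (forall s, m != U_(s)%MM) -> I 'X_[m] = 0).

Definition convolve_Delta (I : A -> tpow k d 2) (a : A) : tpow k d 2 :=
  sweedler (fun a1 a2 => I a1 * Delta a2) a.

Lemma tliftX n (W : lmodType k) (f : n.-tuple A -> W) m :
  tlift f 'X_[m] = f [tuple 'X_[mleg m p] | p < n].
Proof. by rewrite /tlift msuppX big_seq1 mcoeffX eqxx scale1r. Qed.

Lemma mpolyX_tens n (m : 'X_{1..(n * d)%N}) :
  'X_[m] = tens [tuple 'X_[mleg m p] | p < n] :> tpow k d n.
Proof.
rewrite /tens mpolyXE_id (reindex _ (curry_mxvec_bij n d)) /=.
under [RHS]eq_bigr => p _.
  rewrite tnth_mktuple /leg comp_mpolyX.
  under eq_bigr => i _ do rewrite tnth_mktuple mnmE.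
  over.
by rewrite pair_bigA; apply: eq_bigr => -[p i] _.
Qed.

Lemma mleg_bij n :
  bijective (fun m : 'X_{1..(n * d)%N} => [ffun p : 'I_n => mleg m p]).
Proof.
exists (fun g : {ffun 'I_n -> 'X_{1..d}} =>
  [multinom (let: (p, i) := (mxvec_indexP j : 'I_n * 'I_d) in g p i) | j < n * d]).
- move=> m; apply/mnmP => j; rewrite mnmE.
  by case: (mxvec_indexP j) => p i /=; rewrite ffunE mnmE.
- move=> g; apply/ffunP => p; rewrite ffunE; apply/mnmP => i; rewrite !mnmE.
  suff -> : (mxvec_indexP (mxvec_index p i) : 'I_n * 'I_d) = (p, i) by [].
  apply: (bij_inj (onT_bij (curry_mxvec_bij n d))) => /=.
  by move: (mxvec_index p i) (mxvec_indexP _) => j; case: j /.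
Qed.

End TensorPowers.

Record PoissonHopf (k : fieldType) (d : nat) := {
  pbracket :> {mpoly k[d]} -> {mpoly k[d]} -> {mpoly k[d]};
  pbracketP : poisson_hopf pbracket
}.

Record CoPoissonHopf (k : fieldType) (d : nat) := {
  cobracket :> {mpoly k[d]} -> tpow k d 2;
  cobracketP : copoisson_hopf cobracket
}.

(* Main.v *)
Require Import Defs.
From HB Require Import structures.
From Stdlib Require Import FunctionalExtensionality ProofIrrelevance.
From mathcomp Require Import all_boot all_order all_algebra.
From mathcomp Require Import ring.
From mathcomp Require Import mpoly.
Import GRing.Theory.
Local Open Scope ring_scope.
Set Implicit Arguments.
Unset Strict Implicit.
Unset Printing Implicit Defensive.

(** Both kinds of structure are encoded by the structure constants λ_s^{ij} of a
    Lie algebra on the span of the x_i.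

    A Poisson bracket is a biderivation, so
    {a,b} = \sum_{i,j} {x_i,x_j} ∂_i a ∂_j b ([poisson_expand]).  A co-Poisson
    structure is a derivation along Δ, so q(a) = \sum_s q(x_s) Δ(∂_s a)
    ([conv_expand]).  The convolution \sum I(a_1) Δ(a_2) is of this form with
    q(x_s) = I(x_s), because I only sees the linear part of a_1
    ([convolve_DeltaE]).

    With q(x_s) = \sum λ_s^{ij} x_i ⊗ x_j, skewness of q is antisymmetry of λ
    ([bilin_skewP]); compatibility with Δ holds because each q(x_s) is primitive
    in the first factor ([Delta_l_bilin]).  In (q ⊗ 1)q(a) the terms in first
    derivatives of a have cyclic sum zero exactly when λ satisfies the Jacobi
    identity ([bilin_jacobiP]), while the terms in second derivatives always
    cancel: they are antisymmetric coefficients against symmetric derivatives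
    ([cyclic_product_identity], [conv_copoisson]).  All this is valid in every
    characteristic.

    In characteristic zero every structure is of this kind.  The element
    {x_i,x_j} is primitive, and q(x_s) is skew and primitive in its first factor;
    differentiating these conditions and evaluating one tensor factor at the
    origin shows that the first derivatives are constant in the variables of
    that factor, so that Euler's formula makes the element linear in them
    ([euler_linear], [primitive_linear], [biprimitive_bilin]).  Conversely, an
    antisymmetric λ with the Jacobi identity defines a Poisson Hopf structure
    ([bracket_poisson]), and matching the constants gives mutually inverse maps.

    Tensor powers are polynomial rings, so Δ ⊗ 1, cyclic rotations and
    placements of tensor factors are substitutions ([place_tuple], [trotE],
    [tmapl_Delta]).  A map defined by linear extension from pure tensors is
    computed by guessing a linear map with the same values on them
    ([tliftE]). *)

(** * Linear maps *)

Section LinearOps.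
Variables (k : fieldType) (U W : lmodType k).

Lemma linear_sumF (T : Type) (r : seq T) (h : T -> U -> W) :
  (forall s, linear (h s)) -> linear (fun u => \sum_(s <- r) h s u).
Proof.
move=> hl c u v; rewrite scaler_sumr -big_split; apply: eq_bigr => s _.
exact: hl.
Qed.

(** Functions that are merely proved linear, such as sections of a bracket,
    inherit the theory of bundled linear maps. *)
Lemma linear_packP (f : U -> W) : linear f -> exists F : {linear U -> W}, F =1 f.
Proof.
move=> fl.
by exists (HB.pack f (GRing.isLinear.Build k U W _ f fl) : {linear U -> W}).
Qed.

Lemma linear_atD (f : U -> W) : linear f -> {morph f : u v / u + v}.
Proof. by case/linear_packP => F FE u v; rewrite -!FE linearD. Qed.

Lemma linear_atZ (f : U -> W) : linear f -> forall c, {morph f : u / c *: u}.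
Proof. by case/linear_packP => F FE c u; rewrite -!FE linearZ. Qed.

Lemma linear_at_sum (f : U -> W) : linear f ->
  forall (T : Type) (r : seq T) (g : T -> U),
  f (\sum_(i <- r) g i) = \sum_(i <- r) f (g i).
Proof.
case/linear_packP => F FE T r g; rewrite -FE linear_sum.
by apply: eq_bigr => i _; rewrite FE.
Qed.

End LinearOps.

(** * Substitutions and derivations of polynomial rings *)

Section Substitution.
Variables (k : fieldType) (n N : nat).

(** The substitution 'X_i |-> tnth t i, as an algebra morphism.  It is
    [comp_mpoly] under a name of its own, so that the morphism structure is found
    through one head constant. *)
Definition subst (t : n.-tuple {mpoly k[N]}) (a : {mpoly k[n]}) := a \mPo t.

Variable t : n.-tuple {mpoly k[N]}.

Fact subst_is_linear : linear (subst t).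
Proof. exact: linearP. Qed.

Fact subst_is_monoid_morphism : monoid_morphism (subst t).
Proof. by split=> [|a b]; rewrite /subst ?rmorph1 ?rmorphM. Qed.

HB.instance Definition _ :=
  GRing.isLinear.Build k {mpoly k[n]} {mpoly k[N]} _ (subst t) subst_is_linear.
HB.instance Definition _ :=
  GRing.isMonoidMorphism.Build {mpoly k[n]} {mpoly k[N]} (subst t)
    subst_is_monoid_morphism.

Lemma substX i : subst t 'X_i = tnth t i.
Proof. by rewrite /subst comp_mpolyXU -tnth_nth. Qed.

End Substitution.

Section Derivations.
Variables (k : fieldType) (n N : nat).
Local Notation A := {mpoly k[n]}.
Local Notation B := {mpoly k[N]}.

Lemma mderivXU (i j : 'I_n) : ('X_j : A)^`M(i) = (j == i)%:R.
Proof.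
rewrite mderivX mnm1E; case: (j =P i) => [->|_]; last by rewrite scale0r.
by rewrite scale1r -[X in (X - _)%MM]add0m addmK mpolyX0.
Qed.

(** Polynomials are generated, as an algebra, by constants and variables. *)
Lemma mpoly_alg_ind (P : A -> Prop) :
    (forall c, P c%:MP) -> (forall i, P 'X_i) ->
    (forall a b, P a -> P b -> P (a + b)) ->
    (forall a b, P a -> P b -> P (a * b)) ->
  forall a, P a.
Proof.
move=> PC PX PD PM a; rewrite [a]mpolyE.
apply: (big_ind P); [by rewrite -mpolyC0 | exact: PD | move=> m _].
rewrite -mul_mpolyC mpolyXE_id; apply: (PM _ _ (PC _)).
apply: (big_ind P); [by rewrite -mpolyC1 | exact: PM | move=> i _].
by elim: (m i) => [|e IH]; rewrite ?expr0 -?mpolyC1 // exprS; apply: PM.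
Qed.

Lemma subst_ext M (f g : {lrmorphism A -> {mpoly k[M]}}) :
  (forall i, f 'X_i = g 'X_i) -> f =1 g.
Proof.
move=> fgX; apply: mpoly_alg_ind => [c|//|a b fa fb|a b fa fb].
- by rewrite -[c%:MP]mulr1 mul_mpolyC !linearZ !rmorph1.
- by rewrite !raddfD; congr (_ + _).
- by rewrite !rmorphM; congr (_ * _).
Qed.

(** A linear map that is a derivation along an algebra morphism [phi] is
    determined by its values on the variables.  This is what makes brackets,
    cobrackets and partial derivatives comparable. *)
Lemma derivation_expand (phi : {lrmorphism A -> B}) (D : A -> B) :
    linear D -> (forall a b, D (a * b) = D a * phi b + phi a * D b) ->
  forall a, D a = \sum_(i < n) D 'X_i * phi a^`M(i).
Proof.
move=> Dl DM.
have D1 : D 1 = 0.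
  have := DM 1 1; rewrite mulr1 rmorph1 mulr1 mul1r.
  by move/eqP; rewrite -subr_eq0 opprD addrA subrr sub0r oppr_eq0 => /eqP.
apply: mpoly_alg_ind => [c|i|a b Da Db|a b Da Db].
- rewrite -[c%:MP]mulr1 mul_mpolyC (linear_atZ Dl) D1 scaler0.
  rewrite big1 // => i _.
  by rewrite mderivZ -mpolyC1 mderivC scaler0 rmorph0 mulr0.
- rewrite (bigD1 i) //= big1 => [|j ji]; rewrite mderivXU.
    by rewrite eqxx rmorph1 mulr1 addr0.
  by rewrite eq_sym (negPf ji) rmorph0 mulr0.
- rewrite (linear_atD Dl) Da Db -big_split; apply: eq_bigr => i _ /=.
  by rewrite mderivD rmorphD mulrDr.
- rewrite DM Da Db mulr_suml mulr_sumr -big_split; apply: eq_bigr => i _ /=.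
  by rewrite mderivM rmorphD !rmorphM; ring.
Qed.

Lemma chain_rule (t : n.-tuple B) (a : A) (j : 'I_N) :
  (subst t a)^`M(j) = \sum_(i < n) (tnth t i)^`M(j) * subst t a^`M(i).
Proof.
rewrite -[LHS]/((mderiv j \o subst t) a).
rewrite (@derivation_expand (subst t)) /=.
- by apply: eq_bigr => i _; rewrite substX.
- by move=> c u v; rewrite linearP.
- by move=> u v /=; rewrite rmorphM mderivM.
Qed.

Lemma eq_subst (s t : n.-tuple B) (a : A) :
  (forall i, tnth s i = tnth t i) -> subst s a = subst t a.
Proof. by move/eq_from_tnth->. Qed.

Lemma subst_subst M (s : n.-tuple B) (t : N.-tuple {mpoly k[M]}) (a : A) :
  subst t (subst s a) = subst [tuple subst t (tnth s i) | i < n] a.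
Proof.
apply: (@subst_ext M (subst t \o subst s) (subst _)) => i /=.
by rewrite !substX tnth_mktuple.
Qed.

Lemma subst_id (a : A) : subst [tuple 'X_i | i < n] a = a.
Proof. exact: comp_mpoly_id. Qed.

End Derivations.

(** * Tensor powers as polynomial rings *)

Local Notation var p i := ('X_(mxvec_index p i)).

Section Legs.
Variables (k : fieldType) (d : nat).
Local Notation A := {mpoly k[d]}.

(** The images g p i of the variables x_(p,i) of the n-fold tensor power, as
    a tuple suitable for substitution. *)
Definition legs_tuple n N (g : 'I_n -> 'I_d -> {mpoly k[N]}) :=
  [tuple mxvec (\matrix_(p < n, i < d) g p i) 0 j | j < n * d].

Lemma legs_tupleE n N (g : 'I_n -> 'I_d -> {mpoly k[N]}) p i :
  tnth (legs_tuple g) (mxvec_index p i) = g p i.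
Proof. by rewrite tnth_mktuple mxvecE mxE. Qed.

Lemma legs_substX n N (g : 'I_n -> 'I_d -> {mpoly k[N]}) p i :
  subst (legs_tuple g) (var p i) = g p i.
Proof. by rewrite substX legs_tupleE. Qed.

Lemma mxvec_index_eq n (p q : 'I_n) (i j : 'I_d) :
  (mxvec_index p i == mxvec_index q j) = (p == q) && (i == j).
Proof.
apply/eqP/andP => [|[/eqP-> /eqP->]//].
move/(bij_inj (onT_bij (curry_mxvec_bij n d)) (x1 := (p, i)) (x2 := (q, j))).
by case=> -> ->.
Qed.

(** Substituting this tuple is the algebra map A^{⊗m} -> A^{⊗n}, written
    [place phi], that sends the tensor factor in position p to position phi p,
    multiplying the factors that meet and filling the positions that are missed
    with 1. *)
Definition place_tuple m n (phi : 'I_m -> 'I_n) : (m * d).-tuple (tpow k d n) :=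
  legs_tuple (fun p i => var (phi p) i).

End Legs.

Local Notation place phi := (subst (place_tuple _ _ phi)).

Section Tensors.
Variables (k : fieldType) (d : nat).
Local Notation A := {mpoly k[d]}.

Lemma placeX m n (phi : 'I_m -> 'I_n) p i :
  place phi (var p i : tpow k d m) = var (phi p) i.
Proof. exact: legs_substX. Qed.

Lemma legE n (p : 'I_n) (a : A) : leg p a = subst [tuple var p i | i < d] a.
Proof. by []. Qed.

Lemma legX n (p : 'I_n) i : leg p ('X_i : A) = var p i.
Proof. by rewrite legE substX tnth_mktuple. Qed.

Lemma place_leg m n (phi : 'I_m -> 'I_n) p (a : A) :
  place phi (leg p a) = leg (phi p) a.
Proof.
rewrite !legE subst_subst; apply: eq_subst => i.
by rewrite !tnth_mktuple placeX.
Qed.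

Lemma eq_legs_subst n N (s t : (n * d).-tuple {mpoly k[N]}) u :
  (forall p i, tnth s (mxvec_index p i) = tnth t (mxvec_index p i)) ->
  subst s u = subst t u.
Proof. by move=> E; apply: eq_subst => j; case/mxvec_indexP: j. Qed.

Lemma place_comp l m n (phi : 'I_m -> 'I_n) (psi : 'I_l -> 'I_m) (u : tpow k d l) :
  place phi (place psi u) = place (phi \o psi) u.
Proof.
rewrite subst_subst; apply: eq_legs_subst => p i.
by rewrite tnth_mktuple !legs_tupleE placeX.
Qed.

Lemma eq_place m n (phi psi : 'I_m -> 'I_n) (u : tpow k d m) :
  phi =1 psi -> place phi u = place psi u.
Proof. by move=> E; apply: eq_legs_subst => p i; rewrite !legs_tupleE E. Qed.

Lemma place_tens m n (phi : 'I_m -> 'I_n) (v : m.-tuple A) :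
  place phi (tens v) = \prod_(p < m) leg (phi p) (tnth v p).
Proof. by rewrite rmorph_prod; apply: eq_bigr => p _; rewrite /= place_leg. Qed.

(** The universal property: a linear map that agrees with [f] on pure tensors
    is the linear extension of [f].  Each linear extension below is computed by
    exhibiting such a map. *)
Lemma tliftE n (W : lmodType k) (f : n.-tuple A -> W) (h : tpow k d n -> W) :
  linear h -> (forall v, f v = h (tens v)) -> tlift f =1 h.
Proof.
move=> hl fh u; rewrite [in RHS](mpolyE u) (linear_at_sum hl) /tlift.
by apply: eq_bigr => m _; rewrite (linear_atZ hl) [in RHS]mpolyX_tens fh.
Qed.

Lemma tuple2_eta (T : Type) (v : 2.-tuple T) :
  v = [tuple tnth v ord0; tnth v ord_max].
Proof. by case: v => [[|x [|y []]]] // ?; apply: val_inj. Qed.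

Lemma tlift2E (W : lmodType k) (f : A -> A -> W) (h : tpow k d 2 -> W) :
  linear h -> (forall a b, f a b = h (tens2 a b)) -> tlift2 f =1 h.
Proof.
move=> hl fh; apply: tliftE => // v.
by rewrite fh /tens2 -tuple2_eta.
Qed.

Lemma sweedlerE (W : lmodType k) (f : A -> A -> W) (h : tpow k d 2 -> W) a :
  linear h -> (forall a b, f a b = h (tens2 a b)) -> sweedler f a = h (Delta a).
Proof. by move=> hl fh; apply: tlift2E. Qed.

Lemma tens2E (a b : A) : tens2 a b = leg ord0 a * leg ord_max b.
Proof.
have E : lift ord0 ord0 = ord_max :> 'I_2 by exact: val_inj.
by rewrite /tens2 /tens big_ord_recl big_ord1 E !(tnth_nth 0).
Qed.

Lemma linear_mull n N (c : {mpoly k[N]}) (h : {mpoly k[n]} -> {mpoly k[N]}) :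
  linear h -> linear (fun u => c * h u).
Proof. by move=> hl e u v; rewrite hl mulrDr scalerAr. Qed.

Lemma linear_mulr n N (c : {mpoly k[N]}) (h : {mpoly k[n]} -> {mpoly k[N]}) :
  linear h -> linear (fun u => h u * c).
Proof. by move=> hl e u v; rewrite hl mulrDl scalerAl. Qed.

Lemma tcatE m n (u : tpow k d m) (w : tpow k d n) :
  tcat u w = place (lshift n) u * place (@rshift m n) w.
Proof.
apply: (tliftE (linear_mulr _ (subst_is_linear _))) => x.
apply: (tliftE (linear_mull _ (subst_is_linear _))) => y.
rewrite !place_tens /tens big_split_ord /=; congr (_ * _).
  by apply: eq_bigr => p _; rewrite tnth_lshift.
by apply: eq_bigr => p _; rewrite tnth_rshift.
Qed.

(** Cyclic rotation is the algebra map that moves each tensor factor one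
    position up, cyclically. *)
Lemma trotE n (u : tpow k d n.+1) : trot u = place (@ordS n.+1) u.
Proof.
apply: (tliftE (subst_is_linear _)) => v; rewrite place_tens /tens.
rewrite (reindex (@ordS n.+1)) /=; last exact: onW_bij (ordS_bij _).
apply: eq_bigr => p _; congr leg.
rewrite !(tnth_nth 0) /= /rotr size_tuple subSS subn0 /rot.
rewrite nth_cat size_drop size_tuple subSnn.
have [->|lt_p] := eqVneq (p : nat) n.
  by rewrite modnn /= nth_drop addn0.
rewrite modn_small /=; last by rewrite ltnS ltn_neqAle lt_p -ltnS ltn_ord.
by rewrite subn1 nth_take // ltn_neqAle lt_p -ltnS ltn_ord.
Qed.

End Tensors.

(** * Iterated comultiplication and the three-fold tensor power *)

(** The map of positions 0 |-> a, 1 |-> b; the algebra map [at2 a b] then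
    sends u = u' ⊗ u'' to the tensor usually written u^{ab}, with u' in
    position a and u'' in position b. *)
Definition onto2 n (a b : 'I_n) (p : 'I_2) : 'I_n := if p == ord0 then a else b.

Local Notation at2 a b := (place (onto2 a b)).

(** The three positions of A^{⊗3}. *)
Definition slot0 : 'I_3 := @Ordinal 3 0 isT.
Definition slot1 : 'I_3 := @Ordinal 3 1 isT.
Definition slot2 : 'I_3 := @Ordinal 3 2 isT.

Section Coproducts.
Variables (k : fieldType) (d : nat).
Local Notation A := {mpoly k[d]}.

(** The (n-1)-fold iterated comultiplication A -> A^{⊗n}. *)
Definition coprod n : A -> tpow k d n :=
  subst [tuple \sum_(p < n) var p i | i < d].

HB.instance Definition _ n := GRing.LRMorphism.copy (@coprod n) (subst _).

Lemma coprodX n i : coprod n 'X_i = \sum_(p < n) var p i.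
Proof. by rewrite [LHS]substX tnth_mktuple. Qed.

Lemma leg1 n (p : 'I_n) : leg p (1 : A) = 1.
Proof. by rewrite legE rmorph1. Qed.

Lemma DeltaE a : Delta a = coprod 2 a.
Proof.
apply: eq_subst => i; rewrite !tnth_mktuple !tens2E !legX !leg1 mulr1 mul1r.
have E : lift ord0 ord0 = ord_max :> 'I_2 by exact: val_inj.
by rewrite big_ord_recl big_ord1 E.
Qed.

(** Differentiating Δ(a) in one tensor factor gives Δ of the derivative of a. *)
Lemma mderiv_coprod n (p : 'I_n) s a :
  (coprod n a)^`M(mxvec_index p s) = coprod n a^`M(s).
Proof.
rewrite chain_rule (bigD1 s) //= [X in _ + X]big1 => [|i si].
  rewrite addr0 tnth_mktuple linear_sum (bigD1 p) //= mderivXU eqxx.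
  rewrite big1 ?addr0 ?mul1r // => q qp.
  by rewrite mderivXU mxvec_index_eq (negPf qp).
rewrite tnth_mktuple linear_sum big1 ?mul0r // => q _.
by rewrite /= mderivXU mxvec_index_eq (negPf si) andbF.
Qed.

Lemma mderiv_leg n (p q : 'I_n) s (a : A) :
  (leg p a)^`M(mxvec_index q s) = (p == q)%:R * leg p a^`M(s).
Proof.
rewrite !legE chain_rule (bigD1 s) //= [X in _ + X]big1 => [|i si].
  by rewrite addr0 tnth_mktuple mderivXU mxvec_index_eq eqxx andbT.
by rewrite tnth_mktuple mderivXU mxvec_index_eq (negPf si) andbF mul0r.
Qed.

Lemma mderiv_tens2l s (a b : A) :
  (tens2 a b)^`M(mxvec_index ord0 s) = tens2 a^`M(s) b.
Proof. by rewrite !tens2E mderivM !mderiv_leg mul1r mul0r mulr0 addr0. Qed.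

Lemma mderiv_tens2r s (a b : A) :
  (tens2 a b)^`M(mxvec_index ord_max s) = tens2 a b^`M(s).
Proof. by rewrite !tens2E mderivM !mderiv_leg mul1r !mul0r add0r. Qed.

Lemma place_coprod n (phi : 'I_n -> 'I_n) a :
  bijective phi -> place phi (coprod n a) = coprod n a.
Proof.
move=> phi_bij; rewrite [LHS]subst_subst; apply: eq_subst => i.
rewrite !tnth_mktuple linear_sum [RHS](reindex phi) /=; last exact: onW_bij.
by apply: eq_bigr => p _; rewrite placeX.
Qed.

Lemma place_at2 m n (phi : 'I_m -> 'I_n) (p q : 'I_m) (u : tpow k d 2) :
  place phi (at2 p q u) = at2 (phi p) (phi q) u.
Proof.
by rewrite place_comp; apply: eq_place => i; rewrite /= /onto2; case: ifP.
Qed.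

Lemma trot2E (u : tpow k d 2) : trot u = at2 ord_max ord0 u.
Proof.
by rewrite trotE; apply: eq_place; case=> [[|[]]] // ?; apply: val_inj.
Qed.

(** Skew-symmetric tensors satisfy u^{qp} = - u^{pq}. *)
Lemma at2_skew n (p q : 'I_n) (u : tpow k d 2) :
  u + trot u = 0 -> at2 q p u = - at2 p q u.
Proof.
rewrite trot2E => /(congr1 (at2 p q)); rewrite rmorphD rmorph0 /= place_at2.
by move/eqP; rewrite addrC addr_eq0 => /eqP.
Qed.

Lemma trot3_at2 (p q : 'I_3) (u : tpow k d 2) :
  trot (at2 p q u) = at2 (ordS p) (ordS q) u.
Proof. by rewrite trotE place_at2. Qed.

Lemma ordS_slot0 : ordS slot0 = slot1. Proof. exact: val_inj. Qed.
Lemma ordS_slot1 : ordS slot1 = slot2. Proof. exact: val_inj. Qed.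
Lemma ordS_slot2 : ordS slot2 = slot0. Proof. exact: val_inj. Qed.
Definition ordS_slots := (ordS_slot0, ordS_slot1, ordS_slot2).

Lemma big_slots n (F : 'I_3 -> tpow k d n) :
  \sum_(p < 3) F p = F slot0 + F slot1 + F slot2.
Proof.
rewrite !big_ord_recl big_ord0 addr0 addrA.
by congr (F _ + F _ + F _); apply: val_inj.
Qed.

Lemma tcat_tens1r (u : tpow k d 2) (b : A) :
  tcat u (tens [tuple b]) = at2 slot0 slot1 u * leg slot2 b :> tpow k d 3.
Proof.
have lE : @lshift 2 1 =1 onto2 slot0 slot1.
  by case=> [[|[]]] // ?; apply: val_inj.
have rE : @rshift 2 1 ord0 = slot2 by apply: val_inj.
by rewrite tcatE place_tens big_ord1 (eq_place _ lE) rE.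
Qed.

Lemma tcat_tens1l (a : A) (u : tpow k d 2) :
  tcat (tens [tuple a]) u = leg slot0 a * at2 slot1 slot2 u :> tpow k d 3.
Proof.
have rE : @rshift 1 2 =1 onto2 slot1 slot2.
  by case=> [[|[]]] // ?; apply: val_inj.
have lE : @lshift 1 2 ord0 = slot0 by apply: val_inj.
by rewrite tcatE place_tens big_ord1 (eq_place _ rE) lE.
Qed.

(** Δ ⊗ 1 and 1 ⊗ Δ, as algebra maps A^{⊗2} -> A^{⊗3}. *)
Definition Delta_l : tpow k d 2 -> tpow k d 3 :=
  subst (legs_tuple (fun p i =>
    if p == ord0 then var slot0 i + var slot1 i else var slot2 i)).
Definition Delta_r : tpow k d 2 -> tpow k d 3 :=
  subst (legs_tuple (fun p i =>
    if p == ord0 then var slot0 i else var slot1 i + var slot2 i)).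

HB.instance Definition _ := GRing.LRMorphism.copy Delta_l (subst _).
HB.instance Definition _ := GRing.LRMorphism.copy Delta_r (subst _).

Lemma coprod2X i : coprod 2 'X_i = var ord0 i + var ord_max i.
Proof.
have E : lift ord0 ord0 = ord_max :> 'I_2 by exact: val_inj.
by rewrite coprodX big_ord_recl big_ord1 E.
Qed.

Lemma Delta_l_leg0 (a : A) : Delta_l (leg ord0 a) = at2 slot0 slot1 (coprod 2 a).
Proof.
rewrite legE [LHS]subst_subst [RHS]subst_subst; apply: eq_subst => i.
rewrite !tnth_mktuple substX legs_tupleE /= -coprodX coprod2X rmorphD /=.
by rewrite !placeX.
Qed.

Lemma Delta_l_leg1 (a : A) : Delta_l (leg ord_max a) = leg slot2 a.
Proof.
rewrite !legE [LHS]subst_subst; apply: eq_subst => i.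
by rewrite !tnth_mktuple substX legs_tupleE.
Qed.

Lemma Delta_r_leg0 (a : A) : Delta_r (leg ord0 a) = leg slot0 a.
Proof.
rewrite !legE [LHS]subst_subst; apply: eq_subst => i.
by rewrite !tnth_mktuple substX legs_tupleE.
Qed.

Lemma Delta_r_leg1 (a : A) : Delta_r (leg ord_max a) = at2 slot1 slot2 (coprod 2 a).
Proof.
rewrite legE [LHS]subst_subst [RHS]subst_subst; apply: eq_subst => i.
rewrite !tnth_mktuple substX legs_tupleE /= -coprodX coprod2X rmorphD /=.
by rewrite !placeX.
Qed.

Lemma Delta_l_tens2 (a b : A) :
  Delta_l (tens2 a b) = at2 slot0 slot1 (coprod 2 a) * leg slot2 b.
Proof. by rewrite tens2E rmorphM /= Delta_l_leg0 Delta_l_leg1. Qed.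

Lemma Delta_r_tens2 (a b : A) :
  Delta_r (tens2 a b) = leg slot0 a * at2 slot1 slot2 (coprod 2 b).
Proof. by rewrite tens2E rmorphM /= Delta_r_leg0 Delta_r_leg1. Qed.

Lemma Delta_l_coprod a : Delta_l (coprod 2 a) = coprod 3 a.
Proof.
rewrite [LHS]subst_subst; apply: eq_subst => i.
rewrite !tnth_mktuple -coprodX coprod2X rmorphD /= !substX !legs_tupleE /=.
by rewrite big_slots.
Qed.

Lemma Delta_r_coprod a : Delta_r (coprod 2 a) = coprod 3 a.
Proof.
rewrite [LHS]subst_subst; apply: eq_subst => i.
rewrite !tnth_mktuple -coprodX coprod2X rmorphD /= !substX !legs_tupleE /=.
by rewrite big_slots addrA.
Qed.

Lemma tmapl_Delta u : tmapl (@Delta k d) u = Delta_l u.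
Proof.
apply: tlift2E; first exact: linearP.
by move=> a b; rewrite tcat_tens1r Delta_l_tens2 DeltaE.
Qed.

(** The derivation along Δ with value Q s on x_s,
    that is, a |-> \sum_s Q_s Δ(∂a/∂x_s). *)
Definition conv (Q : 'I_d -> tpow k d 2) (a : A) : tpow k d 2 :=
  \sum_(s < d) Q s * coprod 2 a^`M(s).

(** For a derivation q along Δ, the map q ⊗ 1 is a derivation along Δ ⊗ 1
    that differentiates in the first tensor factor only. *)
Lemma tmapl_conv (q : A -> tpow k d 2) Q u : q =1 conv Q ->
  tmapl q u
  = \sum_(s < d) at2 slot0 slot1 (Q s) * Delta_l u^`M(mxvec_index ord0 s).
Proof.
move=> qE; move: u.
pose h v :=
  \sum_(s < d) at2 slot0 slot1 (Q s) * Delta_l v^`M(mxvec_index ord0 s).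
apply: (@tlift2E _ _ _ _ h) => [|a b].
  apply: linear_sumF => s; apply: linear_mull => c v w.
  by rewrite !linearP.
rewrite tcat_tens1r qE /conv linear_sum mulr_suml; apply: eq_bigr => s _ /=.
by rewrite mderiv_tens2l Delta_l_tens2 rmorphM mulrA.
Qed.

Lemma tmapr_conv (q : A -> tpow k d 2) Q u : q =1 conv Q ->
  tmapr q u
  = \sum_(s < d) at2 slot1 slot2 (Q s) * Delta_r u^`M(mxvec_index ord_max s).
Proof.
move=> qE; move: u.
pose h v :=
  \sum_(s < d) at2 slot1 slot2 (Q s) * Delta_r v^`M(mxvec_index ord_max s).
apply: (@tlift2E _ _ _ _ h) => [|a b].
  apply: linear_sumF => s; apply: linear_mull => c v w.
  by rewrite !linearP.
rewrite tcat_tens1l qE /conv linear_sum mulr_sumr; apply: eq_bigr => s _ /=.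
by rewrite mderiv_tens2r Delta_r_tens2 rmorphM mulrCA.
Qed.

End Coproducts.

(** * Cobrackets as derivations along the comultiplication *)

Section Cobrackets.
Variables (k : fieldType) (d : nat).
Local Notation A := {mpoly k[d]}.
Implicit Types (Q : 'I_d -> tpow k d 2) (lam : 'I_d -> 'I_d -> 'I_d -> k).

Lemma conv_linear Q : linear (conv Q).
Proof.
by apply: linear_sumF => s; apply: linear_mull => c u v; rewrite !linearP.
Qed.

Lemma conv_mul Q a b :
  conv Q (a * b) = conv Q a * coprod 2 b + coprod 2 a * conv Q b.
Proof.
rewrite mulr_suml mulr_sumr -big_split; apply: eq_bigr => s _ /=.
by rewrite mderivM rmorphD !rmorphM /=; ring.
Qed.

Lemma convX Q s : conv Q 'X_s = Q s.
Proof.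
rewrite /conv (bigD1 s) //= mderivXU eqxx rmorph1 mulr1 big1 ?addr0 // => r rs.
by rewrite mderivXU eq_sym (negPf rs) rmorph0 mulr0.
Qed.

(** The multiplication rule of a co-Poisson structure says that it is a
    derivation along Δ. *)
Lemma conv_expand (q : A -> tpow k d 2) : linear q ->
    (forall a b, q (a * b) = q a * Delta b + Delta a * q b) ->
  q =1 conv (fun s => q 'X_s).
Proof.
move=> ql qM.
have qM' u v : q (u * v) = q u * coprod 2 v + coprod 2 u * q v.
  by rewrite qM !DeltaE.
exact: (@derivation_expand k d (2 * d) (coprod 2) q ql qM').
Qed.

(** The operator 1 + t_3 + t_3^2 of the co-Jacobi identity. *)
Definition cyc3 (u : tpow k d 3) := u + trot u + trot (trot u).

Fact cyc3_is_linear : linear cyc3.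
Proof.
move=> c u v; rewrite /cyc3 !trotE !linearP /= !scalerDr.
by rewrite (addrACA (c *: u)) [LHS]addrACA.
Qed.

HB.instance Definition _ :=
  GRing.isLinear.Build k (tpow k d 3) (tpow k d 3) _ cyc3 cyc3_is_linear.

Lemma trot_sum (F : 'I_d -> tpow k d 3) :
  trot (\sum_(s < d) F s) = \sum_(s < d) trot (F s).
Proof. by rewrite trotE linear_sum; apply: eq_bigr => s _; rewrite trotE. Qed.

Lemma place3_coprod a : place (@ordS 3) (coprod 3 a : tpow k d 3) = coprod 3 a.
Proof. exact: place_coprod (ordS_bij 3). Qed.

Lemma cyc3_mul_coprod u a : cyc3 (u * coprod 3 a) = cyc3 u * coprod 3 a.
Proof. by rewrite /cyc3 !trotE !rmorphM /= !place3_coprod !mulrDl. Qed.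

Lemma eq_tmapl (f g : A -> tpow k d 2) : f =1 g -> tmapl f =1 tmapl g.
Proof.
move=> E u; apply: eq_bigr => m _; congr (_ *: _).
by rewrite E.
Qed.

(** Iterating q gives a part of first order in a, governed by the values
    (q ⊗ 1)q(x_s), and a part of second order with coefficients
    Q_r^{01} (Δ ⊗ 1)(Q_s). *)
Lemma tmapl_conv_conv Q a :
  tmapl (conv Q) (conv Q a)
  = \sum_(s < d) tmapl (conv Q) (Q s) * coprod 3 a^`M(s)
  + \sum_(r < d) \sum_(s < d)
      at2 slot0 slot1 (Q r) * Delta_l (Q s) * coprod 3 a^`M(s)^`M(r).
Proof.
rewrite (tmapl_conv _ (Q := Q)) // /conv.
under eq_bigr => r _.
  rewrite (raddf_sum (mderiv _)) /=.
  rewrite raddf_sum /= mulr_sumr /=.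
  under eq_bigr => s _.
    rewrite mderivM mderiv_coprod rmorphD !rmorphM /= !Delta_l_coprod.
    rewrite mulrDr !mulrA.
    over.
  rewrite big_split /=; over.
rewrite big_split /= exchange_big /=; congr (_ + _).
apply: eq_bigr => s _; rewrite (tmapl_conv _ (Q := Q)) // mulr_suml.
by apply: eq_bigr.
Qed.

(** The left-hand side is the cyclic sum of Q_r^{01} (Q_s^{02} + Q_s^{12}), the
    coefficient of the second-order part of (q ⊗ 1)q, written with
    ar = Q_r^{01}, br = Q_r^{12}, cr = Q_r^{02} and likewise as', bs, cs for
    Q_s.  It has the form G(r,s) - G(s,r), so it cancels against the symmetric
    second derivatives in every characteristic. *)
Lemma cyclic_product_identity (R : comRingType) (ar br cr as' bs cs : R) :
  ar * (cs + bs) + br * (- as' + - cs) + - cr * (- bs + as')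
  = ar * cs + ar * bs + cr * bs - (as' * cr + as' * br + cs * br).
Proof. by ring. Qed.

(** The co-Poisson axioms need only be checked on the variables: skewness,
    primitivity in the first tensor factor, and the co-Jacobi identity. *)
Lemma conv_copoisson Q :
    (forall s, Q s + trot (Q s) = 0) ->
    (forall s, Delta_l (Q s) = at2 slot0 slot2 (Q s) + at2 slot1 slot2 (Q s)) ->
    (forall s, cyc3 (tmapl (conv Q) (Q s)) = 0) ->
  copoisson_hopf (conv Q).
Proof.
move=> Qskew Qprim Qcyc.
split=> [||a|a|a b].
- exact: conv_linear.
- move=> a; rewrite trotE linear_sum -big_split big1 // => s _ /=.
  rewrite rmorphM /= place_coprod; last exact: ordS_bij.
  by rewrite -mulrDl -trotE Qskew mul0r.
- rewrite /= -/(cyc3 _) tmapl_conv_conv linearD /= [X in X + _]linear_sum.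
  rewrite big1 ?add0r => [|s _] /=; last first.
    by rewrite cyc3_mul_coprod Qcyc mul0r.
  (* Only the second-order part is left: it is the sum of
     (G r s - G s r) * E r s, with E symmetric. *)
  pose G r s := (at2 slot0 slot1 (Q r) * at2 slot0 slot2 (Q s)
    + at2 slot0 slot1 (Q r) * at2 slot1 slot2 (Q s)
    + at2 slot0 slot2 (Q r) * at2 slot1 slot2 (Q s)).
  pose E r s := coprod 3 a^`M(s)^`M(r).
  rewrite linear_sum /= (eq_bigr (fun r => \sum_(s < d) G r s * E r s
      - \sum_(s < d) G s r * E r s)) => [|r _]; last first.
    rewrite linear_sum -sumrB; apply: eq_bigr => s _ /=.
    rewrite cyc3_mul_coprod Qprim -mulrBl /E; congr (_ * _).
    rewrite /cyc3 !trotE !rmorphM !rmorphD /= !place_at2 !ordS_slots.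
    rewrite !(at2_skew slot0 slot2 (Qskew _)) !(at2_skew slot0 slot1 (Qskew _)).
    rewrite !(at2_skew slot1 slot2 (Qskew _)) /G.
    exact: cyclic_product_identity.
  rewrite sumrB.
  apply/eqP; rewrite subr_eq0 [X in _ == X]exchange_big; apply/eqP.
  apply: eq_bigr => r _; apply: eq_bigr => s _; congr (_ * _).
  by rewrite /E mderiv_comm.
- rewrite tmapl_Delta (tmapr_conv _ (Q := Q)) // (tmapl_conv _ (Q := Q)) //.
  rewrite !trot_sum (linear_sum (@Delta_l k d)) /= -sumrB.
  apply: eq_bigr => s _; rewrite !trotE.
  rewrite !rmorphM /= DeltaE !mderiv_coprod Delta_l_coprod Delta_r_coprod.
  rewrite !place3_coprod !place_at2 !ordS_slots Qprim.
  by rewrite (at2_skew slot0 slot2 (Qskew _)); ring.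
- by rewrite conv_mul !DeltaE.
Qed.

End Cobrackets.

(** * Structure constants and the convolution formula *)

Section StructureConstants.
Variables (k : fieldType) (d : nat).
Local Notation A := {mpoly k[d]}.
Implicit Types lam : 'I_d -> 'I_d -> 'I_d -> k.

(** The structure constants lam s i j = λ_s^{ij} are antisymmetric in i, j. *)
Definition antisymmetric_const lam := forall s i j, lam s j i = - lam s i j.

(** One of the three cyclic terms of the Jacobi identity for the structure
    constants: \sum_r λ_r^{ab} λ_s^{rc}. *)
Definition jacobi_sum lam s a b c := \sum_(r < d) lam r a b * lam s r c.

(** The Jacobi identity for the bracket with structure constants λ. *)
Definition jacobi_const lam := forall s a b c,
  jacobi_sum lam s a b c + jacobi_sum lam s b c a + jacobi_sum lam s c a b = 0.

Lemma mcoeff_sum_monomials n (I : finType) (t : I -> k) (m : I -> 'X_{1..n}) j :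
  injective m -> (\sum_i t i *: 'X_[m i])@_(m j) = t j.
Proof.
move=> m_inj; rewrite linear_sum (bigD1 j) //= mcoeffZ mcoeffX eqxx mulr1.
rewrite big1 ?addr0 // => i ij.
by rewrite mcoeffZ mcoeffX (inj_eq m_inj) (negPf ij) mulr0.
Qed.

(** The tensor \sum_{i,j} λ_s^{ij} x_i ⊗ x_j. *)
Definition bilin lam s : tpow k d 2 :=
  \sum_(i < d) \sum_(j < d) lam s i j *: (var ord0 i * var ord_max j).

(** The tensor \sum_{a,b,c} t(a,b,c) x_a ⊗ x_b ⊗ x_c. *)
Definition trilin (t : 'I_d -> 'I_d -> 'I_d -> k) : tpow k d 3 :=
  \sum_(a < d) \sum_(b < d) \sum_(c < d)
    t a b c *: (var slot0 a * var slot1 b * var slot2 c).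

Lemma bilin_inj lam lam' s :
  bilin lam s = bilin lam' s -> forall i j, lam s i j = lam' s i j.
Proof.
pose m (x : 'I_d * 'I_d) : 'X_{1..(2 * d)%N} :=
  (U_(mxvec_index ord0 x.1) + U_(mxvec_index ord_max x.2))%MM.
have m_inj : injective m.
  move=> [i j] [i' j'] /mnmP E.
  have := E (mxvec_index ord0 i); have := E (mxvec_index ord_max j).
  rewrite !mnmDE !mnm1E !mxvec_index_eq !eqxx /=.
  by case: eqP => // -> _; case: eqP => // ->.
have bE l i j : (bilin l s)@_(m (i, j)) = l s i j.
  rewrite -(@mcoeff_sum_monomials _ _ (fun x => l s x.1 x.2) m (i, j)) //.
  rewrite /bilin pair_bigA; congr (_@__); apply: eq_bigr => x _.
  by rewrite mpolyXD.
by move=> E i j; rewrite -!bE E.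
Qed.

Lemma trilin_eq0 t : trilin t = 0 -> forall a b c, t a b c = 0.
Proof.
pose m (x : 'I_d * ('I_d * 'I_d)) : 'X_{1..(3 * d)%N} :=
  (U_(mxvec_index slot0 x.1) + U_(mxvec_index slot1 x.2.1)
   + U_(mxvec_index slot2 x.2.2))%MM.
have m_inj : injective m.
  move=> [a [b c]] [a' [b' c']] /mnmP E.
  have := E (mxvec_index slot0 a); have := E (mxvec_index slot1 b).
  have := E (mxvec_index slot2 c).
  rewrite !mnmDE !mnm1E !mxvec_index_eq !eqxx /=.
  by case: eqP => // -> _; case: eqP => // -> _; case: eqP => // ->.
move=> t0 a b c; have <- : (trilin t)@_(m (a, (b, c))) = t a b c.
  rewrite -(@mcoeff_sum_monomials _ _ (fun x => t x.1 x.2.1 x.2.2) m (a, (b, c))) //.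
  rewrite /trilin; congr (_@__).
  under eq_bigr => i _ do rewrite pair_bigA.
  by rewrite pair_bigA; apply: eq_bigr => x _; rewrite !mpolyXD.
by rewrite t0 mcoeff0.
Qed.

Lemma at2_bilin n (p q : 'I_n) lam s :
  at2 p q (bilin lam s)
  = \sum_(i < d) \sum_(j < d) lam s i j *: (var p i * var q j).
Proof.
rewrite linear_sum; apply: eq_bigr => i _ /=.
rewrite linear_sum; apply: eq_bigr => j _ /=.
by rewrite linearZ rmorphM /= !placeX.
Qed.

Lemma trot_bilin lam s :
  trot (bilin lam s) = bilin (fun s i j => lam s j i) s.
Proof.
rewrite trot2E at2_bilin exchange_big; apply: eq_bigr => i _.
by apply: eq_bigr => j _; rewrite mulrC.
Qed.

Lemma bilinD_trot lam s :
  bilin lam s + trot (bilin lam s)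
  = bilin (fun s i j => lam s i j + lam s j i) s.
Proof.
rewrite trot_bilin -big_split; apply: eq_bigr => i _.
by rewrite -big_split; apply: eq_bigr => j _; rewrite scalerDl.
Qed.

Lemma bilin0 s : bilin (fun _ _ _ => 0) s = 0.
Proof. by rewrite /bilin big1 // => i _; rewrite big1 // => j _; rewrite scale0r. Qed.

(** Skewness of the tensors and antisymmetry of the constants are equivalent. *)
Lemma bilin_skewP lam :
  (forall s, bilin lam s + trot (bilin lam s) = 0) <-> antisymmetric_const lam.
Proof.
split=> [H s i j|H s].
  have := H s; rewrite bilinD_trot -(bilin0 s) => /bilin_inj/(_ i j)/eqP.
  by rewrite addrC addr_eq0 => /eqP.
rewrite bilinD_trot -(bilin0 s); apply: eq_bigr => i _; apply: eq_bigr => j _.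
by rewrite (H s i j) subrr.
Qed.

Lemma Delta_l_bilin lam s :
  Delta_l (bilin lam s)
  = at2 slot0 slot2 (bilin lam s) + at2 slot1 slot2 (bilin lam s).
Proof.
rewrite !at2_bilin -big_split linear_sum; apply: eq_bigr => i _ /=.
rewrite -big_split linear_sum; apply: eq_bigr => j _ /=.
by rewrite linearZ rmorphM /= /Delta_l !substX !legs_tupleE /= mulrDl scalerDr.
Qed.

Lemma mderiv_bilin lam s r :
  (bilin lam s)^`M(mxvec_index ord0 r)
  = \sum_(c < d) lam s r c *: var ord_max c.
Proof.
rewrite linear_sum (bigD1 r) //= [X in _ + X]big1 => [|i ir].
  rewrite addr0 linear_sum; apply: eq_bigr => j _ /=.
  rewrite mderivZ mderivM !mderivXU !mxvec_index_eq !eqxx /=.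
  by rewrite mul1r mulr0 addr0.
rewrite linear_sum big1 // => j _ /=.
rewrite mderivZ mderivM !mderivXU !mxvec_index_eq (negPf ir) /=.
by rewrite mul0r mulr0 addr0 scaler0.
Qed.

Lemma tmapl_bilin lam s :
  tmapl (conv (bilin lam)) (bilin lam s) = trilin (jacobi_sum lam s).
Proof.
rewrite (tmapl_conv _ (Q := bilin lam)) //.
have E r : at2 slot0 slot1 (bilin lam r)
      * Delta_l (bilin lam s)^`M(mxvec_index ord0 r)
    = \sum_(a < d) \sum_(b < d) \sum_(c < d)
        (lam r a b * lam s r c) *: (var slot0 a * var slot1 b * var slot2 c).
  rewrite mderiv_bilin at2_bilin mulr_suml; apply: eq_bigr => a _.
  rewrite mulr_suml; apply: eq_bigr => b _.
  rewrite linear_sum mulr_sumr; apply: eq_bigr => c _ /=.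
  rewrite linearZ /= /Delta_l substX legs_tupleE /=.
  by rewrite -scalerAr -scalerAl scalerA mulrC.
under eq_bigr => r _ do rewrite E.
rewrite exchange_big; apply: eq_bigr => a _.
rewrite exchange_big; apply: eq_bigr => b _.
rewrite exchange_big; apply: eq_bigr => c _.
by rewrite -scaler_suml.
Qed.

Lemma trot_trilin t : trot (trilin t) = trilin (fun a b c => t b c a).
Proof.
rewrite trotE linear_sum [RHS]exchange_big; apply: eq_bigr => a _ /=.
rewrite linear_sum [RHS]exchange_big; apply: eq_bigr => b _ /=.
rewrite linear_sum; apply: eq_bigr => c _ /=.
by rewrite linearZ !rmorphM /= !placeX !ordS_slots mulrC mulrA.
Qed.

Lemma trilinD t u : trilin t + trilin u = trilin (fun a b c => t a b c + u a b c).
Proof.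
rewrite -big_split; apply: eq_bigr => a _; rewrite -big_split; apply: eq_bigr => b _.
by rewrite -big_split; apply: eq_bigr => c _; rewrite scalerDl.
Qed.

(** The co-Jacobi identity on the variables is the Jacobi identity of the
    structure constants. *)
Lemma bilin_jacobiP lam :
  (forall s, cyc3 (tmapl (conv (bilin lam)) (bilin lam s)) = 0)
  <-> jacobi_const lam.
Proof.
have E s : cyc3 (tmapl (conv (bilin lam)) (bilin lam s))
    = trilin (fun a b c => jacobi_sum lam s a b c + jacobi_sum lam s b c a
                           + jacobi_sum lam s c a b).
  by rewrite tmapl_bilin /cyc3 !trot_trilin !trilinD.
split=> H s; first by move=> a b c; move: (H s); rewrite E => /trilin_eq0.
rewrite E /trilin big1 // => a _; rewrite big1 // => b _; rewrite big1 // => c _.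
by rewrite H scale0r.
Qed.

Lemma bilin_copoisson lam : antisymmetric_const lam -> jacobi_const lam ->
  copoisson_hopf (conv (bilin lam)).
Proof.
move=> /bilin_skewP skew /bilin_jacobiP jac.
by apply: conv_copoisson => //; apply: Delta_l_bilin.
Qed.

Lemma subst0 n N (a : {mpoly k[n]}) :
  subst [tuple 0 | _ < n] a = (a@_0)%:MP_[N].
Proof.
elim/mpoly_alg_ind: a => [c|i|a b Ea Eb|a b Ea Eb].
- by rewrite /subst comp_mpolyC mcoeffC eqxx mulr1.
- by rewrite substX tnth_mktuple mcoeffX mnm1_eq0 mpolyC0.
- by rewrite rmorphD /= Ea Eb mcoeffD mpolyCD.
- by rewrite rmorphM /= Ea Eb (rmorphM (mcoeff 0%MM)) mpolyCM.
Qed.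

(** ε ⊗ 1 : A ⊗ A -> A, with ε the evaluation at the origin. *)
Definition counit_l : tpow k d 2 -> A :=
  subst (legs_tuple (fun p i => if p == ord0 then 0 else 'X_i)).

HB.instance Definition _ := GRing.LRMorphism.copy counit_l (subst _).

Lemma counit_l_coprod a : counit_l (coprod 2 a) = a.
Proof.
rewrite [LHS]subst_subst -[RHS]subst_id; apply: eq_subst => i.
rewrite !tnth_mktuple -coprodX coprod2X rmorphD /= !substX !legs_tupleE /=.
by rewrite add0r.
Qed.

Lemma counit_l_leg0 a : counit_l (leg ord0 a) = (a@_0)%:MP.
Proof.
rewrite -subst0 legE [LHS]subst_subst; apply: eq_subst => i.
by rewrite !tnth_mktuple substX legs_tupleE.
Qed.

Lemma counit_l_leg1 a : counit_l (leg ord_max a) = a.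
Proof.
rewrite -[RHS]subst_id legE [LHS]subst_subst; apply: eq_subst => i.
by rewrite !tnth_mktuple substX legs_tupleE.
Qed.

(** The map I of the correspondence: it applies x_s |-> \sum λ_s^{ij} x_i ⊗ x_j
    to the linear part of a polynomial and forgets the other monomials. *)
Definition linear_part_map lam (a : A) : tpow k d 2 :=
  \sum_(s < d) a@_U_(s) *: bilin lam s.

Fact linear_part_map_is_linear lam : linear (linear_part_map lam).
Proof.
by apply: linear_sumF => s c u v; rewrite mcoeffD mcoeffZ scalerDl scalerA.
Qed.

HB.instance Definition _ lam :=
  GRing.isLinear.Build k A (tpow k d 2) _ (linear_part_map lam)
    (linear_part_map_is_linear lam).

Lemma linear_part_mapP lam : dual_map lam (linear_part_map lam).
Proof.
split=> [s|m mU].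
  rewrite /= /linear_part_map (bigD1 s) //= mcoeffXU eqxx scale1r.
  rewrite big1 ?addr0 => [|r rs].
    do 2 (apply: eq_bigr => ? _); by rewrite tens2E !legX.
  by rewrite mcoeffXU eq_sym (negPf rs) scale0r.
rewrite /= /linear_part_map big1 // => s _.
by rewrite mcoeffX (negPf (mU s)) scale0r.
Qed.

(** The map I is determined by its defining conditions. *)
Lemma dual_mapE lam (I : {linear A -> tpow k d 2}) : dual_map lam I ->
  I =1 linear_part_map lam.
Proof.
move=> [IX I0] a; have [JX J0] := linear_part_mapP lam.
rewrite [a]mpolyE !linear_sum; apply: eq_bigr => m _; rewrite !linearZ.
congr (_ *: _).
have [/existsP[s /eqP->]|] := boolP [exists s, m == U_(s)%MM].
  by rewrite [LHS]IX -JX.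
by rewrite negb_exists => /forallP mU; rewrite [LHS]I0 // [RHS]J0.
Qed.

(** The convolution of I and Δ is the derivation along Δ with values I(x_s):
    I only sees the linear part of a_1, and \sum (a_1)_{x_s} a_2 = ∂a/∂x_s. *)
Lemma convolve_DeltaE lam (I : {linear A -> tpow k d 2}) : dual_map lam I ->
  convolve_Delta I =1 conv (bilin lam).
Proof.
move=> Ilam a.
pose h u := \sum_(s < d)
  bilin lam s * coprod 2 (counit_l u^`M(mxvec_index ord0 s)).
rewrite /convolve_Delta (@sweedlerE _ _ _ _ h).
- rewrite DeltaE; apply: eq_bigr => s _.
  by rewrite mderiv_coprod counit_l_coprod.
- by apply: linear_sumF => s; apply: linear_mull => c u v; rewrite !linearP.
move=> b c; rewrite (dual_mapE Ilam) mulr_suml; apply: eq_bigr => s _.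
rewrite mderiv_tens2l tens2E rmorphM /= counit_l_leg0 counit_l_leg1.
rewrite mcoeff_mderiv add0m mnm0E mulr1n mul_mpolyC linearZ /= DeltaE.
by rewrite -scalerAl -scalerAr.
Qed.

End StructureConstants.

(** * Poisson brackets *)

Section Brackets.
Variables (k : fieldType) (d : nat).
Local Notation A := {mpoly k[d]}.
Implicit Types (lam : 'I_d -> 'I_d -> 'I_d -> k) (L : 'I_d -> 'I_d -> A).

(** The biderivation \sum_{i,j} L_{ij} (∂a/∂x_i) (∂b/∂x_j), with value
    L i j on ('X_i, 'X_j). *)
Definition bracket L (a b : A) : A :=
  \sum_(i < d) \sum_(j < d) L i j * (a^`M(i) * b^`M(j)).

(** The linear form λ_1^{ij} x_1 + ... + λ_d^{ij} x_d. *)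
Definition linform lam i j : A := \sum_(s < d) lam s i j *: 'X_s.

Lemma bracketX L i j : bracket L 'X_i 'X_j = L i j.
Proof.
rewrite /bracket (bigD1 i) //= [X in _ + X]big1 => [|r ri]; last first.
  by rewrite big1 // => s _; rewrite mderivXU eq_sym (negPf ri) mul0r mulr0.
rewrite addr0 (bigD1 j) //= !mderivXU !eqxx !mulr1 big1 ?addr0 // => r rj.
by rewrite mderivXU [j == r]eq_sym (negPf rj) !mulr0.
Qed.

Lemma mcoeff_linform lam s i j : (linform lam i j)@_U_(s) = lam s i j.
Proof.
rewrite linear_sum (bigD1 s) //= mcoeffZ mcoeffXU eqxx mulr1.
rewrite big1 ?addr0 // => r rs.
by rewrite mcoeffZ mcoeffXU (negPf rs) mulr0.
Qed.

Lemma linform_antisym lam : antisymmetric_const lam ->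
  forall i j, linform lam j i = - linform lam i j.
Proof.
move=> skew i j; rewrite -sumrN; apply: eq_bigr => s _.
by rewrite skew scaleNr.
Qed.

Lemma coprod2_linform lam i j :
  coprod 2 (linform lam i j)
  = leg ord0 (linform lam i j) + leg ord_max (linform lam i j).
Proof.
rewrite !legE !linear_sum -big_split; apply: eq_bigr => s _ /=.
by rewrite !linearZ -scalerDr /= coprod2X -!legE !legX.
Qed.

Lemma poisson_antisym (br : A -> A -> A) : poisson_hopf br ->
  forall a b, br b a = - br a b.
Proof.
case=> brl brr br0 _ _ _ a b; apply/eqP; rewrite -addr_eq0; apply/eqP.
have := br0 (a + b).
rewrite (linear_atD (brl _)) !(linear_atD (brr _)) !br0 add0r addr0.
by rewrite addrC.
Qed.

(** A Poisson bracket is a biderivation, hence determined by its values on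
    the variables. *)
Lemma poisson_expand (br : A -> A -> A) : poisson_hopf br ->
  forall a b, br a b = bracket (fun i j => br 'X_i 'X_j) a b.
Proof.
move=> brP; have brN := poisson_antisym brP; case: brP => brl brr _ _ brM _.
have brE c a : br a c = \sum_(i < d) br 'X_i c * a^`M(i).
  apply: (@derivation_expand k d d idfun (br^~ c) (brl c)) => u v /=.
  by rewrite brM addrC.
move=> a b; rewrite brE; apply: eq_bigr => i _.
rewrite brN brE -sumrN mulr_suml; apply: eq_bigr => j _.
by rewrite -mulNr -brN mulrAC -mulrA.
Qed.

(** The two halves of the right-hand side of the compatibility of a
    biderivation with Δ. *)
Lemma sweedler_bracket_l L (br : A -> A -> A) a b : br =2 bracket L ->
  sweedler (fun a1 a2 =>
    sweedler (fun b1 b2 => tens2 (br a1 b1) (a2 * b2)) b) a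
  = \sum_(i < d) \sum_(j < d)
      leg ord0 (L i j) * (coprod 2 a^`M(i) * coprod 2 b^`M(j)).
Proof.
move=> brE.
pose h u := \sum_(i < d) \sum_(j < d) leg ord0 (L i j)
  * (u^`M(mxvec_index ord0 i) * coprod 2 b^`M(j)).
rewrite (@sweedlerE _ _ _ _ h).
- by rewrite DeltaE; do 2 (apply: eq_bigr => ? _); rewrite mderiv_coprod.
- do 2 apply: linear_sumF => ?; apply: linear_mull; apply: linear_mulr.
  by move=> c u v; rewrite linearP.
move=> a1 a2.
pose g u := \sum_(i < d) \sum_(j < d) leg ord0 (L i j)
  * ((tens2 a1 a2)^`M(mxvec_index ord0 i) * u^`M(mxvec_index ord0 j)).
rewrite (@sweedlerE _ _ _ _ g).
- by rewrite DeltaE; do 2 (apply: eq_bigr => ? _); rewrite mderiv_coprod.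
- do 2 apply: linear_sumF => ?; do 2 apply: linear_mull.
  by move=> c u v; rewrite linearP.
move=> b1 b2; rewrite tens2E brE legE linear_sum mulr_suml.
apply: eq_bigr => i _; rewrite linear_sum mulr_suml; apply: eq_bigr => j _ /=.
rewrite !mderiv_tens2l !tens2E !legE !rmorphM /=.
by rewrite -mulrA mulrACA.
Qed.

Lemma sweedler_bracket_r L (br : A -> A -> A) a b : br =2 bracket L ->
  sweedler (fun a1 a2 =>
    sweedler (fun b1 b2 => tens2 (a1 * b1) (br a2 b2)) b) a
  = \sum_(i < d) \sum_(j < d)
      leg ord_max (L i j) * (coprod 2 a^`M(i) * coprod 2 b^`M(j)).
Proof.
move=> brE.
pose h u := \sum_(i < d) \sum_(j < d) leg ord_max (L i j)
  * (u^`M(mxvec_index ord_max i) * coprod 2 b^`M(j)).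
rewrite (@sweedlerE _ _ _ _ h).
- by rewrite DeltaE; do 2 (apply: eq_bigr => ? _); rewrite mderiv_coprod.
- do 2 apply: linear_sumF => ?; apply: linear_mull; apply: linear_mulr.
  by move=> c u v; rewrite linearP.
move=> a1 a2.
pose g u := \sum_(i < d) \sum_(j < d) leg ord_max (L i j)
  * ((tens2 a1 a2)^`M(mxvec_index ord_max i) * u^`M(mxvec_index ord_max j)).
rewrite (@sweedlerE _ _ _ _ g).
- by rewrite DeltaE; do 2 (apply: eq_bigr => ? _); rewrite mderiv_coprod.
- do 2 apply: linear_sumF => ?; do 2 apply: linear_mull.
  by move=> c u v; rewrite linearP.
move=> b1 b2; rewrite tens2E brE [leg ord_max (bracket _ _ _)]legE linear_sum.
rewrite mulr_sumr; apply: eq_bigr => i _; rewrite linear_sum mulr_sumr.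
apply: eq_bigr => j _ /=; rewrite !mderiv_tens2r !tens2E !legE !rmorphM /=.
by rewrite mulrCA mulrACA.
Qed.

(** The bracket of two variables is primitive. *)
Lemma poisson_primitive (br : A -> A -> A) i j : poisson_hopf br ->
  coprod 2 (br 'X_i 'X_j)
  = leg ord0 (br 'X_i 'X_j) + leg ord_max (br 'X_i 'X_j).
Proof.
move=> brP; have brE := poisson_expand brP.
have S (F : 'I_d -> 'I_d -> tpow k d 2) :
    \sum_(r < d) \sum_(s < d)
      F r s * (coprod 2 ('X_i : A)^`M(r) * coprod 2 ('X_j : A)^`M(s)) = F i j.
  rewrite (bigD1 i) //= [X in _ + X]big1 => [|r ri]; last first.
    rewrite big1 // => s _.
    by rewrite mderivXU eq_sym (negPf ri) rmorph0 mul0r mulr0.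
  rewrite addr0 (bigD1 j) //= !mderivXU !eqxx !rmorph1 !mulr1.
  rewrite big1 ?addr0 // => r rj.
  by rewrite mderivXU [j == r]eq_sym (negPf rj) rmorph0 !mulr0.
rewrite -DeltaE (br_Delta brP) (sweedler_bracket_l _ _ brE).
by rewrite (sweedler_bracket_r _ _ brE) !S.
Qed.

Lemma poisson_const (br : A -> A -> A) lam :
    poisson_hopf br -> linear_bracket lam br ->
  antisymmetric_const lam /\ jacobi_const lam.
Proof.
move=> brP brX; have brN := poisson_antisym brP.
have brE i j : br 'X_i 'X_j = linform lam i j by apply: brX.
have skew : antisymmetric_const lam.
  by move=> s i j; rewrite -!mcoeff_linform -!brE brN mcoeffN.
split=> // s a b c.
have E x y z : (br 'X_x (br 'X_y 'X_z))@_U_(s) = - jacobi_sum lam s y z x.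
  rewrite brE (linear_at_sum (br_linear_r brP _)) linear_sum -sumrN.
  apply: eq_bigr => t _; rewrite (linear_atZ (br_linear_r brP _)) /=.
  by rewrite mcoeffZ brE mcoeff_linform (skew s t x) mulrN.
have := congr1 (mcoeff U_(s)%MM) (br_jacobi brP 'X_c 'X_a 'X_b).
by rewrite !mcoeffD mcoeff0 !E -!opprD => /eqP; rewrite oppr_eq0 => /eqP.
Qed.

(** The Jacobiator of an antisymmetric biderivation is a derivation in each
    argument, so it vanishes as soon as it does on the variables. *)
Lemma jacobi_of_generators (br : A -> A -> A) :
    (forall c, linear (br^~ c)) -> (forall c, linear (br c)) ->
    (forall a b, br b a = - br a b) ->
    (forall a b c, br (a * b) c = a * br b c + br a c * b) ->
    (forall i j l, br 'X_i (br 'X_j 'X_l) + br 'X_j (br 'X_l 'X_i)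
                   + br 'X_l (br 'X_i 'X_j) = 0) ->
  forall a b c, br a (br b c) + br b (br c a) + br c (br a b) = 0.
Proof.
move=> brl brr brN brM JX.
pose J a b c := br a (br b c) + br b (br c a) + br c (br a b).
have brM' a b c : br c (a * b) = a * br c b + br c a * b.
  by rewrite brN brM opprD -mulrN -mulNr -!brN.
have Jcyc a b c : J a b c = J b c a by rewrite /J -addrA addrC.
(* The mixed products cancel by antisymmetry. *)
have JE b c a : J a b c = \sum_(i < d) J 'X_i b c * a^`M(i).
  apply: (@derivation_expand k d d idfun (fun u => J u b c)) => [|u v] /=.
    move=> e u v; rewrite /J brl brr (brr b) brl (brr c) !scalerDr.
    by rewrite (addrACA (e *: br u _)) [LHS]addrACA.
  rewrite /J !brM !brM' (linear_atD (brr b)) (linear_atD (brr c)) !brM'.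
  by rewrite (brN b u) (brN b v); ring.
move=> a b c; rewrite -/(J a b c) JE big1 // => i _.
rewrite Jcyc JE big1 ?mul0r // => j _; rewrite Jcyc JE big1 ?mul0r // => l _.
by rewrite /J JX mul0r.
Qed.

End Brackets.

(** * The correspondence in characteristic zero *)

Section CharacteristicZero.
Variables (k : fieldType) (d : nat).
Hypothesis char0 : [pchar k] =i pred0.
Local Notation A := {mpoly k[d]}.
Implicit Types lam : 'I_d -> 'I_d -> 'I_d -> k.

Lemma natr_eq0 n : (n%:R == 0 :> k) = (n == 0)%N.
Proof. exact: (proj1 (@pcharf0P k) char0). Qed.

Lemma double_eq0 (V : lmodType k) (v : V) : v + v = 0 -> v = 0.
Proof.
rewrite -mulr2n -scaler_nat => /eqP; rewrite scaler_eq0.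
by rewrite natr_eq0 /= => /eqP.
Qed.

(** Substituting this tuple is the algebra map, written [kill S], that sets the
    variables in S to 0 and fixes the others. *)
Definition kill_tuple n (S : pred 'I_n) : n.-tuple {mpoly k[n]} :=
  [tuple if S j then 0 else 'X_j | j < n].
Local Notation kill S := (subst (kill_tuple S)).

Lemma mderiv_kill n (S : pred 'I_n) i f : S i -> (kill S f)^`M(i) = 0.
Proof.
move=> Si; rewrite chain_rule big1 // => j _; rewrite tnth_mktuple.
case: ifP => [_|Sj]; first by rewrite mderiv0 mul0r.
rewrite mderivXU; case: eqP => [ji|_]; last by rewrite mul0r.
by rewrite ji Si in Sj.
Qed.

(** In characteristic zero, a polynomial whose derivatives in the variables of
    S vanish does not involve these variables. *)
Lemma kill_fix n (S : pred 'I_n) f :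
  (forall i, S i -> f^`M(i) = 0) -> kill S f = f.
Proof.
move=> f0; rewrite {1}[f]mpolyE linear_sum [RHS]mpolyE !big_seq.
apply: eq_bigr => m mf /=; rewrite linearZ; congr (_ *: _).
rewrite /= /subst comp_mpolyX [RHS]mpolyXE_id; apply: eq_bigr => i _.
rewrite tnth_mktuple; case: ifP => // Si; suff -> : m i = 0%N by rewrite !expr0.
apply/eqP/negP => /negP mi.
(* The coefficient of m - U_i in the derivative is m_i times that of m in f. *)
have := congr1 (mcoeff (m - U_(i))%MM) (f0 i Si).
have Um : (U_(i) <= m)%MM.
  by apply/mnm_lepP => j; rewrite mnm1E; case: eqP => [<-|//]; rewrite lt0n.
rewrite mcoeff_mderiv submK // mcoeff0 -mulr_natl => /eqP.
by rewrite mulf_eq0 natr_eq0 /= -[_ == 0]negbK -mcoeff_msupp mf.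
Qed.

(** Euler's formula in degree one: if the derivatives of f in the variables of
    S do not involve S, and f vanishes where these variables do, then f is linear
    in S.  It fails in characteristic p, for instance for a p-th power. *)
Lemma euler_linear n (h : 'I_d -> 'I_n) (S : pred 'I_n) f :
    injective h -> (forall j, S j = (j \in codom h)) ->
    (forall i, S i -> kill S f^`M(i) = f^`M(i)) -> kill S f = 0 ->
  f = \sum_(i < d) 'X_(h i) * f^`M(h i).
Proof.
move=> h_inj Sh fK f0; apply/eqP; rewrite -subr_eq0; apply/eqP.
have Shi i : S (h i) by rewrite Sh codom_f.
have ff0 i j : f^`M(h i)^`M(h j) = 0.
  by rewrite -(fK _ (Shi i)) mderiv_kill.
rewrite -[LHS](@kill_fix _ S) => [|j]; last first.
  rewrite Sh => /codomP[i ->]; rewrite mderivB (raddf_sum (mderiv (h i))).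
  rewrite (bigD1 i) //=.
  rewrite mderivM mderivXU eqxx ff0 mul1r mulr0 addr0.
  rewrite big1 ?addr0 ?subrr // => l li.
  by rewrite mderivM mderivXU (inj_eq h_inj) (negPf li) ff0 mulr0 mul0r addr0.
rewrite rmorphB rmorph_sum /= f0 sub0r big1 ?oppr0 // => i _.
by rewrite rmorphM /= substX tnth_mktuple Shi mul0r.
Qed.

Lemma deriv0_const n (f : {mpoly k[n]}) :
  (forall i, f^`M(i) = 0) -> f = (f@_0)%:MP.
Proof.
by move=> f0; rewrite -subst0 -[LHS](@kill_fix _ predT).
Qed.

(** In characteristic zero, primitive polynomials are linear forms. *)
Lemma primitive_linear (f : A) :
    coprod 2 f = leg ord0 f + leg ord_max f ->
  f = \sum_(s < d) f@_U_(s) *: 'X_s.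
Proof.
move=> f_prim.
(* Differentiate in the first factor, then evaluate it at the origin. *)
have df s : f^`M(s) = (f@_U_(s))%:MP.
  have := congr1 (mderiv (mxvec_index ord0 s)) f_prim.
  rewrite mderiv_coprod mderivD !mderiv_leg mul1r mul0r addr0.
  move/(congr1 (@counit_l k d)); rewrite counit_l_coprod counit_l_leg0 => ->.
  by rewrite mcoeff_mderiv add0m mnm0E mulr1n.
have f0 : f@_0 = 0.
  have := congr1 (@counit_l k d) f_prim.
  rewrite rmorphD /= counit_l_coprod counit_l_leg0 counit_l_leg1.
  move/eqP; rewrite -subr_eq subrr eq_sym => /eqP.
  by move/(congr1 (mcoeff 0%MM)); rewrite mcoeffC eqxx mulr1 mcoeff0.
rewrite [LHS](@euler_linear _ id predT) //.
- by apply: eq_bigr => s _; rewrite df mulrC mul_mpolyC.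
- by move=> j; rewrite codom_f.
- by move=> i _; rewrite df /subst comp_mpolyC.
rewrite -[RHS]mpolyC0 -f0 -subst0; apply: eq_subst => i.
by rewrite !tnth_mktuple.
Qed.

(** Antisymmetric constants satisfying the Jacobi identity define a Poisson
    Hopf structure. *)
Lemma bracket_poisson lam : antisymmetric_const lam -> jacobi_const lam ->
  poisson_hopf (bracket (linform lam)).
Proof.
move=> skew jac; set br := bracket _.
have brl c : linear (br^~ c).
  do 2 apply: linear_sumF => ?; apply: linear_mull; apply: linear_mulr.
  by move=> e u v; rewrite linearP.
have brr c : linear (br c).
  do 2 apply: linear_sumF => ?; do 2 apply: linear_mull.
  by move=> e u v; rewrite linearP.
have brN a b : br b a = - br a b.
  rewrite /br /bracket exchange_big -sumrN; apply: eq_bigr => i _.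
  rewrite -sumrN; apply: eq_bigr => j _.
  by rewrite (linform_antisym skew) mulNr [X in _ * X]mulrC.
have brM a b c : br (a * b) c = a * br b c + br a c * b.
  rewrite /br /bracket mulr_sumr mulr_suml -big_split; apply: eq_bigr => i _ /=.
  rewrite mulr_sumr mulr_suml -big_split; apply: eq_bigr => j _ /=.
  by rewrite mderivM; ring.
split=> // [a|a b c|a b].
(* Antisymmetry implies alternation, as 2 is invertible. *)
- by apply: double_eq0; rewrite {1}brN addNr.
- apply: jacobi_of_generators => // i j l.
  have E x y z : br 'X_x (br 'X_y 'X_z)
      = - \sum_(s < d) jacobi_sum lam s y z x *: 'X_s.
    rewrite {2}/br bracketX (linear_at_sum (brr _)) -sumrN.
    under eq_bigr => t _.
      rewrite (linear_atZ (brr _)) /= /br bracketX scaler_sumr.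
      over.
    rewrite exchange_big; apply: eq_bigr => s _.
    rewrite -scaleNr -sumrN scaler_suml; apply: eq_bigr => t _.
    by rewrite scalerA (skew s t x) mulrN.
  rewrite !E -!opprD -!big_split big1 ?oppr0 // => s _ /=.
  by rewrite -!scalerDl addrC addrA jac scale0r.
rewrite (@sweedler_bracket_l _ _ (linform lam)) //.
rewrite (@sweedler_bracket_r _ _ (linform lam)) // DeltaE linear_sum -big_split.
apply: eq_bigr => i _ /=; rewrite linear_sum -big_split.
apply: eq_bigr => j _ /=; rewrite !rmorphM /= coprod2_linform.
by rewrite mulrDl.
Qed.

(** The constants λ_s^{ij} read off from a bracket: the coefficient of x_s in
    {x_i, x_j}. *)
Definition poisson_consts (br : A -> A -> A) s i j : k := (br 'X_i 'X_j)@_U_(s).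

Lemma poisson_linear_bracket br :
  poisson_hopf br -> linear_bracket (poisson_consts br) br.
Proof. by move=> brP i j; apply: primitive_linear; apply: poisson_primitive. Qed.

(** ε ⊗ 1 ⊗ 1 : A^{⊗3} -> A^{⊗2}. *)
Definition counit3_l : tpow k d 3 -> tpow k d 2 :=
  subst (legs_tuple (fun p i =>
    if p == slot0 then 0 else if p == slot1 then var ord0 i else var ord_max i)).

HB.instance Definition _ := GRing.LRMorphism.copy counit3_l (subst _).

(** The variables x_(0,i) of A ⊗ A, those of the first tensor factor. *)
Definition in_leg0 (j : 'I_(2 * d)) := j \in codom (@mxvec_index 2 d ord0).

Lemma in_leg0E (p : 'I_2) i : in_leg0 (mxvec_index p i) = (p == ord0).
Proof.
apply/codomP/eqP => [[j /eqP]|->]; last by exists i.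
by rewrite mxvec_index_eq => /andP[/eqP].
Qed.

Lemma counit3_l_Delta_l u : counit3_l (Delta_l u) = u.
Proof.
rewrite [LHS]subst_subst -[RHS]subst_id; apply: eq_legs_subst => p i.
rewrite !tnth_mktuple mxvecE mxE.
case: eqP => [->|/eqP p1].
  by rewrite rmorphD /= /counit3_l !substX !legs_tupleE /= add0r.
rewrite substX legs_tupleE /=; congr ('X_(mxvec_index _ _)).
by apply: val_inj; case: p p1 => [[|[]]].
Qed.

Lemma counit3_l_at12 u : counit3_l (at2 slot1 slot2 u) = u.
Proof.
rewrite [LHS]subst_subst -[RHS]subst_id; apply: eq_legs_subst => p i.
rewrite !tnth_mktuple mxvecE mxE substX legs_tupleE.
by case: p => [[|[]]] // ?; congr ('X_(mxvec_index _ _)); apply: val_inj.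
Qed.

Lemma counit3_l_at02 u : counit3_l (at2 slot0 slot2 u) = kill in_leg0 u.
Proof.
rewrite [LHS]subst_subst; apply: eq_legs_subst => p i.
rewrite !tnth_mktuple mxvecE mxE substX legs_tupleE in_leg0E.
by case: p => [[|[]]] // ?; congr ('X_(mxvec_index _ _)); apply: val_inj.
Qed.

Lemma mderiv_at2 (p q : 'I_3) i (u : tpow k d 2) : p != q -> q != slot0 ->
  (at2 p q u)^`M(mxvec_index slot0 i)
  = (p == slot0)%:R * at2 p q u^`M(mxvec_index ord0 i).
Proof.
move=> pq q_neq0; rewrite chain_rule (bigD1 (mxvec_index ord0 i)) //=.
rewrite legs_tupleE mderivXU mxvec_index_eq eqxx andbT big1 ?addr0 // => j ji.
case/mxvec_indexP: j ji => r j; rewrite mxvec_index_eq legs_tupleE mderivXU.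
rewrite mxvec_index_eq /onto2.
case: eqP => [->|_]; rewrite ?(negPf q_neq0) /= ?mul0r // => /negPf->.
by rewrite andbF mul0r.
Qed.

Lemma mderiv_Delta_l i (u : tpow k d 2) :
  (Delta_l u)^`M(mxvec_index slot0 i) = Delta_l u^`M(mxvec_index ord0 i).
Proof.
rewrite chain_rule (bigD1 (mxvec_index ord0 i)) //=.
rewrite legs_tupleE /= mderivD !mderivXU !mxvec_index_eq !eqxx /= addr0 mul1r.
rewrite big1 ?addr0 // => j ji.
case/mxvec_indexP: j ji => r j; rewrite mxvec_index_eq legs_tupleE.
case: eqP => [_ /= /negPf ji|_ _]; last by rewrite mderivXU mxvec_index_eq mul0r.
by rewrite mderivD !mderivXU !mxvec_index_eq ji /= addr0 mul0r.
Qed.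

(** The constants λ_s^{ij} read off from a cobracket: the coefficient of
    x_i ⊗ x_j in q(x_s), obtained as the value at the origin of a mixed
    derivative. *)
Definition copoisson_consts (q : A -> tpow k d 2) s i j : k :=
  ((q 'X_s)^`M(mxvec_index ord0 i)^`M(mxvec_index ord_max j))@_0.

(** A tensor that is primitive in its first factor is linear in it. *)
Lemma leg0_linear (u : tpow k d 2) :
    Delta_l u = at2 slot0 slot2 u + at2 slot1 slot2 u ->
  u = \sum_(i < d) var ord0 i * u^`M(mxvec_index ord0 i)
  /\ forall i j, u^`M(mxvec_index ord0 i)^`M(mxvec_index ord0 j) = 0.
Proof.
move=> u_prim.
have du i : kill in_leg0 u^`M(mxvec_index ord0 i) = u^`M(mxvec_index ord0 i).
  have := congr1 (mderiv (mxvec_index slot0 i)) u_prim.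
  rewrite mderiv_Delta_l mderivD !mderiv_at2 // mul1r mul0r addr0.
  by move/(congr1 counit3_l); rewrite counit3_l_Delta_l counit3_l_at02.
have u0 : kill in_leg0 u = 0.
  have := congr1 counit3_l u_prim.
  rewrite rmorphD /= counit3_l_Delta_l counit3_l_at02 counit3_l_at12.
  by move/eqP; rewrite -subr_eq subrr eq_sym => /eqP.
split=> [|i j]; last by rewrite -du mderiv_kill // in_leg0E.
apply: (@euler_linear _ _ in_leg0) => // [i j /eqP|j].
  by rewrite mxvec_index_eq => /andP[_ /eqP].
by case/mxvec_indexP: j => p i; rewrite in_leg0E => /eqP->.
Qed.

Lemma mderiv_trot (u : tpow k d 2) i :
  trot (u^`M(mxvec_index ord0 i)) = (trot u)^`M(mxvec_index ord_max i).
Proof.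
rewrite !trot2E chain_rule (bigD1 (mxvec_index ord0 i)) //=.
rewrite legs_tupleE mderivXU mxvec_index_eq !eqxx mul1r big1 ?addr0 // => j ji.
case/mxvec_indexP: j ji => r j; rewrite mxvec_index_eq legs_tupleE mderivXU.
rewrite mxvec_index_eq /onto2.
by case: eqP => [_ /= /negPf->|_ _]; rewrite /= mul0r.
Qed.

(** A skew tensor that is primitive in its first factor is a combination of
    the x_i ⊗ x_j. *)
Lemma biprimitive_bilin (u : tpow k d 2) :
    u + trot u = 0 -> Delta_l u = at2 slot0 slot2 u + at2 slot1 slot2 u ->
  u = \sum_(i < d) \sum_(j < d)
    (u^`M(mxvec_index ord0 i)^`M(mxvec_index ord_max j))@_0
      *: (var ord0 i * var ord_max j).
Proof.
move=> u_skew /leg0_linear[uE du0].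
have tu : trot u = - u by apply/eqP; rewrite -addr_eq0 addrC u_skew.
have trotN v : trot (- v : tpow k d 2) = - trot v by rewrite !trotE rmorphN.
have ordS_ord0 : ordS (ord0 : 'I_2) = ord_max by apply: val_inj.
(* Skewness transports linearity from the first tensor factor to the second. *)
have uE1 : u = \sum_(j < d) var ord_max j * u^`M(mxvec_index ord_max j).
  apply: oppr_inj; rewrite -tu {1}uE trotE linear_sum -sumrN.
  apply: eq_bigr => j _ /=; rewrite rmorphM /= placeX -trotE mderiv_trot tu.
  by rewrite ordS_ord0 mderivN mulrN.
have du1 i j : u^`M(mxvec_index ord_max i)^`M(mxvec_index ord_max j) = 0.
  apply: oppr_inj; rewrite -!mderivN -tu -!mderiv_trot du0 oppr0.
  by rewrite trotE rmorph0.
have w_const i j : u^`M(mxvec_index ord0 i)^`M(mxvec_index ord_max j)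
    = ((u^`M(mxvec_index ord0 i)^`M(mxvec_index ord_max j))@_0)%:MP.
  apply: deriv0_const => r; case/mxvec_indexP: r => p r.
  have [->|p1] : p = ord0 \/ p = ord_max.
  - by case: p => [[|[]]] // ?; [left | right]; apply: val_inj.
  - by rewrite mderiv_comm du0 mderiv0.
  by rewrite p1 (mderiv_comm (mxvec_index ord0 i)) mderiv_comm du1 mderiv0.
rewrite {1}uE; apply: eq_bigr => i _; rewrite {1}uE1 linear_sum mulr_sumr.
apply: eq_bigr => j _ /=.
rewrite mderivM mderivXU mxvec_index_eq /= mul0r add0r.
rewrite (mderiv_comm (mxvec_index ord_max j)) [X in _ * (_ * X)]w_const.
by rewrite mulrA [LHS]mulrC mul_mpolyC.
Qed.

(** The compatibility of q with Δ, read on a variable, says that q(x_s) is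
    primitive in its first factor. *)
Lemma copoisson_bilin q : copoisson_hopf q ->
  forall s, q 'X_s = bilin (copoisson_consts q) s.
Proof.
move=> qP s; have qE := conv_expand (q_linear qP) (q_mul qP).
apply: biprimitive_bilin; first exact: q_skew.
have := q_coleibniz qP 'X_s; rewrite tmapl_Delta => ->.
rewrite (tmapr_conv _ qE) (tmapl_conv _ qE) DeltaE.
have S (F : 'I_d -> tpow k d 3) (f : {lrmorphism tpow k d 2 -> tpow k d 3}) p :
    \sum_(r < d) F r * f (coprod 2 'X_s)^`M(mxvec_index p r) = F s.
  rewrite (bigD1 s) //= mderiv_coprod mderivXU eqxx !rmorph1 mulr1.
  rewrite big1 ?addr0 // => r rs.
  by rewrite mderiv_coprod mderivXU eq_sym (negPf rs) !rmorph0 mulr0.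
rewrite !S !trot3_at2 !ordS_slots (at2_skew slot0 slot2 (q_skew qP _)) opprK.
by rewrite addrC.
Qed.

Lemma copoisson_const q : copoisson_hopf q ->
  antisymmetric_const (copoisson_consts q) /\ jacobi_const (copoisson_consts q).
Proof.
move=> qP; have qX := copoisson_bilin qP.
have qE a : q a = conv (bilin (copoisson_consts q)) a.
  rewrite (conv_expand (q_linear qP) (q_mul qP)).
  by apply: eq_bigr => s _; rewrite qX.
split; [apply/bilin_skewP => s | apply/bilin_jacobiP => s].
  by rewrite -qX; apply: q_skew.
rewrite -(eq_tmapl qE) -qX; exact: q_cojacobi qP 'X_s.
Qed.

Lemma poisson_const0 br : poisson_hopf br ->
  antisymmetric_const (poisson_consts br) /\ jacobi_const (poisson_consts br).
Proof. by move=> brP; apply: (poisson_const brP); apply: poisson_linear_bracket. Qed.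

(** The two directions of the correspondence: structures with the same
    constants correspond to each other. *)
Definition to_copoisson (P : PoissonHopf k d) : CoPoissonHopf k d :=
  let lamP := poisson_const0 (pbracketP P) in
  Build_CoPoissonHopf (bilin_copoisson (proj1 lamP) (proj2 lamP)).

Definition to_poisson (q : CoPoissonHopf k d) : PoissonHopf k d :=
  let lamP := copoisson_const (cobracketP q) in
  Build_PoissonHopf (bracket_poisson (proj1 lamP) (proj2 lamP)).

Lemma PoissonHopf_eq (P P' : PoissonHopf k d) : P =2 P' -> P = P'.
Proof.
case: P P' => [b bP] [b' bP'] /= E.
have {}E : b = b'.
  by do 2 (apply: functional_extensionality => ?); apply: E.
by case: _ / E bP' => bP'; rewrite (proof_irrelevance _ bP bP').
Qed.

Lemma CoPoissonHopf_eq (q q' : CoPoissonHopf k d) : q =1 q' -> q = q'.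
Proof.
case: q q' => [b bP] [b' bP'] /= E.
have {}E : b = b' by apply: functional_extensionality.
by case: _ / E bP' => bP'; rewrite (proof_irrelevance _ bP bP').
Qed.

Lemma to_copoissonK : cancel to_copoisson to_poisson.
Proof.
move=> P; apply: PoissonHopf_eq => a b /=.
rewrite [RHS](poisson_expand (pbracketP P)).
do 2 (apply: eq_bigr => ? _); congr (_ * _).
rewrite (poisson_linear_bracket (pbracketP P)); apply: eq_bigr => s _.
congr (_ *: _); apply: (@bilin_inj k d) => /=.
by rewrite -(copoisson_bilin (cobracketP (to_copoisson P))) /= convX.
Qed.

Lemma to_poissonK : cancel to_poisson to_copoisson.
Proof.
move=> q; apply: CoPoissonHopf_eq => a /=.
rewrite [RHS](conv_expand (q_linear (cobracketP q)) (q_mul (cobracketP q))).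
apply: eq_bigr => s _; congr (_ * _).
rewrite (copoisson_bilin (cobracketP q)); do 2 (apply: eq_bigr => ? _).
by rewrite /poisson_consts /= bracketX mcoeff_linform.
Qed.

End CharacteristicZero.

Theorem theorem5p10 (k : fieldType) (d : nat) :
  ([pchar k] =i pred0 ->
     exists F : PoissonHopf k d -> CoPoissonHopf k d,
       bijective F
       /\ forall P : PoissonHopf k d,
            exists lam : 'I_d -> 'I_d -> 'I_d -> k,
            exists I : {linear {mpoly k[d]} -> tpow k d 2},
              linear_bracket lam P /\ dual_map lam I
              /\ forall a, F P a = convolve_Delta I a)
  /\ (forall (br : {mpoly k[d]} -> {mpoly k[d]} -> {mpoly k[d]})
             (lam : 'I_d -> 'I_d -> 'I_d -> k)
             (I : {linear {mpoly k[d]} -> tpow k d 2}),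
        poisson_hopf br -> linear_bracket lam br -> dual_map lam I ->
        copoisson_hopf (convolve_Delta I)).
Proof.
split=> [char0|br lam I brP brX Ilam].
  exists (to_copoisson char0); split.
    by exists (to_poisson char0); [apply: to_copoissonK | apply: to_poissonK].
  move=> P; exists (poisson_consts P); exists (linear_part_map (poisson_consts P)).
  have IP := linear_part_mapP (poisson_consts P).
  split; [exact: poisson_linear_bracket (pbracketP P) | split=> // a].
  by rewrite (convolve_DeltaE IP).
have [skew jac] := poisson_const brP brX.
have -> : convolve_Delta I = conv (bilin lam).
  by apply: functional_extensionality; apply: convolve_DeltaE.
exact: bilin_copoisson.
Qed.
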